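(* Let $\Theta$ be a suitable set of moduli of continuity and let $E\subset\mathrm{WTC}_\Theta(\mathbb R^M)$ have $L^1_{loc}$-equicontinuous $m$-bounds. Let $\overline E$ be the closure of $E$ in $(\mathrm{WTC}_\Theta(\mathbb R^M),\sigma_\Theta)$. Then the map $\varphi:\mathbb R\times\overline E\to\mathrm{WTC}_\Theta(\mathbb R^M)$, $\varphi(t,f)=f_t$, is well defined and continuous (with $\overline E$ and $\mathrm{WTC}_\Theta(\mathbb R^M)$ carrying $\sigma_\Theta$). In particular, if $f\in\mathrm{WTC}_\Theta(\mathbb R^M)$ has $L^1_{loc}$-equicontinuous $m$-bounds, then $(t,g)\mapsto g_t$ defines a continuous flow on $\mathrm{Hull}_{(\mathrm{WTC}_\Theta,\sigma_\Theta)}(f)$.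
   Context: Notation: $|\cdot|$ is the Euclidean norm on $\mathbb R^N$ and $B_j$ the closed ball of $\mathbb R^N$ of radius $j$ centered at $0$. $L^1_{loc}$ denotes real functions on $\mathbb R$ integrable on every compact interval. For $f:\mathbb R\times\mathbb R^N\to\mathbb R^M$ and $t\in\mathbb R$, $f_t(s,x)=f(s+t,x)$. A function $f$ satisfies (C1) if it is Borel measurable, and (C2) if for every compact $K\subset\mathbb R^N$ there is $m^K\in L^1_{loc}$ (an $m$-bound of $f$ on $K$) with $|f(t,x)|\le m^K(t)$ for all $x\in K$ and a.e. $t$. A suitable set of moduli of continuity is a countable family $\Theta=\{\theta^I_j\mid j\in\mathbb N,\ I=[q_1,q_2],\ q_1<q_2,\ q_1,q_2\in\mathbb Q\}$ of nondecreasing continuous functions $\theta^I_j:\mathbb R^+\to\mathbb R^+$ with $\theta^I_j(0)=0$ and $\theta^{I_1}_{j_1}\le\theta^{I_2}_{j_2}$ whenever $I_1\subseteq I_2$ and $j_1\le j_2$. $\mathcal K^I_j$ is the set of continuous $x:I\to B_j$ admitting $\theta^I_j$ as modulus of continuity. $\mathrm{WTC}_\Theta(\mathbb R^M)$ is the set of $f$ satisfying (C1), (C2) and (W): for each $j$ and $I=[q_1,q_2]$ with rational endpoints, if $x_n\in\mathcal K^I_j$ converge uniformly to $x\in\mathcal K^I_j$ then $\int_I f(t,x_n(t))dt\to\int_I f(t,x(t))dt$; functions differing only on a null subset of $\mathbb R^{1+N}$ are identified. $\sigma_\Theta$ is the topology on $\mathrm{WTC}_\Theta(\mathbb R^M)$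 generated by the seminorms $p_{I,j}(f)=\sup_{x\in\mathcal K^I_j}|\int_I f(t,x(t))\,dt|$. A set $S$ of nonnegative functions in $L^1_{loc}$ is $L^1_{loc}$-equicontinuous if for all $r,\varepsilon>0$ there is $\delta>0$ with $\sup_{m\in S}\int_s^t m<\varepsilon$ whenever $-r\le s\le t\le r$, $t-s<\delta$. A set $E$ has $L^1_{loc}$-equicontinuous $m$-bounds if for every $j\in\mathbb N$ there is an $L^1_{loc}$-equicontinuous set $S^j\subset L^1_{loc}$ consisting of $m$-bounds on $B_j$ of the functions of $E$ (one for each function); a single function $f$ has $L^1_{loc}$-equicontinuous $m$-bounds if $\{f_t\mid t\in\mathbb R\}$ does. $\mathrm{Hull}_{(\mathrm{WTC}_\Theta,\sigma_\Theta)}(f)$ is the closure of $\{f_t\mid t\in\mathbb R\}$ in $(\mathrm{WTC}_\Theta(\mathbb R^M),\sigma_\Theta)$. *)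

(* Defs.v *)
From HB Require Import structures.
From mathcomp Require Import all_boot all_order all_algebra.
From mathcomp Require Import all_classical all_reals all_analysis.
Set Implicit Arguments. Unset Strict Implicit. Unset Printing Implicit Defensive.
Import Order.TTheory GRing.Theory Num.Theory.
Import numFieldNormedType.Exports.
Local Open Scope classical_set_scope.
Local Open Scope ring_scope.

Section WTCDefs.
Variable R : realType.

Definition eucl n (v : 'rV[R]_n) : R := Num.sqrt (\sum_(i < n) v ord0 i ^+ 2).

Definition cball n (j : nat) : set 'rV[R]_n := [set x | eucl x <= j%:R].

Definition fn (N M : nat) := R -> 'rV[R]_N -> 'rV[R]_M.

Definition tshift N M (t : R) (f : fn N M) : fn N M := fun s x => f (s + t) x.

Definition borel (T : topologicalType) : set (set T) := <<s open >>.

Definition C1 N M (f : fn N M) : Prop :=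
  forall B : set 'rV[R]_M, borel B ->
    borel ((fun p : R * 'rV[R]_N => f p.1 p.2) @^-1` B).

Definition L1loc (m : R -> R) : Prop :=
  forall a b : R, (@lebesgue_measure R).-integrable `[a, b] (EFin \o m).

Definition mbound N M (f : fn N M) (K : set 'rV[R]_N) (m : R -> R) : Prop :=
  {ae (@lebesgue_measure R), forall t, forall x, K x -> eucl (f t x) <= m t}.

Definition C2 N M (f : fn N M) : Prop :=
  forall K : set 'rV[R]_N, compact K -> exists m, L1loc m /\ mbound f K m.

(* a family of moduli theta^{[q1,q2]}_j, indexed by j and rationals q1 < q2 *)
Definition Theta := nat -> rat -> rat -> R -> R.

Definition suitable_moduli (th : Theta) : Prop :=
  (forall j q1 q2, q1 < q2 ->
     [/\ (forall u v, 0 <= u -> u <= v -> th j q1 q2 u <= th j q1 q2 v),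
         {within [set u : R | 0 <= u], continuous (th j q1 q2)},
         (forall u, 0 <= u -> 0 <= th j q1 q2 u) &
         th j q1 q2 0 = 0]) /\
  (forall j1 j2 a1 b1 a2 b2, a1 < b1 -> a2 < b2 ->
     a2 <= a1 -> b1 <= b2 -> (j1 <= j2)%N ->
     forall u, 0 <= u -> th j1 a1 b1 u <= th j2 a2 b2 u).

Definition rI (q1 q2 : rat) : set R := `[ratr q1, ratr q2].

Definition Kset N (th : Theta) (j : nat) (q1 q2 : rat) : set (R -> 'rV[R]_N) :=
  [set x | [/\ {within rI q1 q2, continuous x},
              (forall t, rI q1 q2 t -> cball j (x t)) &
              (forall s t, rI q1 q2 s -> rI q1 q2 t ->
                 eucl (x t - x s) <= th j q1 q2 `|t - s|)]].

Definition vint M (a b : R) (g : R -> 'rV[R]_M) : 'rV[R]_M :=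
  \row_k Rintegral (@lebesgue_measure R) `[a, b] (fun t => g t ord0 k).

Definition condW N M (th : Theta) (f : fn N M) : Prop :=
  forall j q1 q2, q1 < q2 ->
  forall (xs : nat -> R -> 'rV[R]_N) (x : R -> 'rV[R]_N),
    (forall n, Kset th j q1 q2 (xs n)) -> Kset th j q1 q2 x ->
    (forall e, 0 < e -> \forall n \near \oo,
        forall t, rI q1 q2 t -> eucl (xs n t - x t) < e) ->
    (forall e, 0 < e -> \forall n \near \oo,
        eucl (vint (ratr q1) (ratr q2) (fun t => f t (xs n t))
              - vint (ratr q1) (ratr q2) (fun t => f t (x t))) < e).

Definition WTC N M (th : Theta) (f : fn N M) : Prop :=
  [/\ C1 f, C2 f & condW th f].

Definition pIj N M (th : Theta) (j : nat) (q1 q2 : rat) (f : fn N M) : \bar R :=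
  ereal_sup [set (eucl (vint (ratr q1) (ratr q2) (fun t => f t (x t))))%:E
            | x in Kset th j q1 q2].

(* index (j, q1, q2) of a seminorm *)
Definition idx := (nat * rat * rat)%type.

(* g lies in the basic sigma_Theta-neighbourhood of f given by the finite
   family F of seminorms and radius eps *)
Definition snear N M (th : Theta) (F : seq idx) (eps : R) (f g : fn N M) : Prop :=
  forall i, i \in F -> i.1.2 < i.2 ->
    (pIj th i.1.1 i.1.2 i.2 (fun t x => g t x - f t x) < eps%:E)%O.

Definition sclosure N M (th : Theta) (E : set (fn N M)) : set (fn N M) :=
  [set g | WTC th g /\
     forall (F : seq idx) (eps : R), 0 < eps -> exists2 e, E e & snear th F eps g e].

Definition equicont_mbounds N M (E : set (fn N M)) : Prop :=
  forall j : nat, exists mb : fn N M -> R -> R,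
    (forall f, E f -> [/\ L1loc (mb f), (forall t, 0 <= mb f t) &
                          mbound f (cball j) (mb f)]) /\
    (forall r eps : R, 0 < r -> 0 < eps -> exists2 d : R, 0 < d &
       forall f, E f -> forall s t : R, - r <= s -> s <= t -> t <= r ->
         t - s < d -> Rintegral (@lebesgue_measure R) `[s, t] (mb f) < eps).

Definition shift_continuous_on N M (th : Theta) (D : set (fn N M)) : Prop :=
  forall (t0 : R) (f0 : fn N M), D f0 ->
  forall (F : seq idx) (eps : R), 0 < eps ->
  exists (d : R) (F' : seq idx) (eta : R),
    [/\ 0 < d, 0 < eta &
      forall (t : R) (f : fn N M), D f -> `|t - t0| < d ->
        snear th F' eta f0 f -> snear th F eps (tshift t0 f0) (tshift t f)].

End WTCDefs.

(* Main.v *)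
Require Import Defs.
From HB Require Import structures.
From mathcomp Require Import all_boot all_order all_algebra.
From mathcomp Require Import all_classical all_reals all_analysis.
From mathcomp Require Import measurable_realfun lra.
Set Implicit Arguments. Unset Strict Implicit. Unset Printing Implicit Defensive.
Import Order.TTheory GRing.Theory Num.Theory.
Import numFieldNormedType.Exports.
Local Open Scope classical_set_scope.
Local Open Scope ring_scope.

(* A curve [x] in [K_j^I], translated by [t] and extended by its endpoint values,
   lies in [K_j^J] for every rational segment [J] containing [I] and [I + t].
   Hence the integral of [f_t] along [x] over [I] is the integral of [f] along
   the extended curve over [J], minus two integrals of [f] along constant curves
   over segments with real endpoints. By Arzela-Ascoli [K_j^J] is compact, so (W)
   makes the first integral uniformly continuous in the curve, hence in [t]. The
   integrals along constant curves are handled by rational approximation of the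
   endpoints, the error being controlled uniformly on the closure of [E] by the
   equicontinuous m-bounds of [E]. *)

Section EuclideanNorm.
Context {R : realType}.

Lemma coord_le_eucl n (v : 'rV[R]_n) k : `|v ord0 k| <= eucl v.
Proof.
rewrite -sqrtr_sqr ler_sqrt; last by apply: sumr_ge0 => i _; exact: sqr_ge0.
by rewrite (bigD1 k)//= lerDl sumr_ge0// => i _; exact: sqr_ge0.
Qed.

Lemma eucl_le n (v : 'rV[R]_n) e : (forall k, `|v ord0 k| <= e) ->
  eucl v <= n%:R * e.
Proof.
case: n v => [|n] v ve; first by rewrite mul0r /eucl big_ord0 sqrtr0.
have e0 : 0 <= e by apply: le_trans (ve ord0).
rewrite -[leRHS]ger0_norm ?mulr_ge0// -sqrtr_sqr ler_sqrt ?sqr_ge0//.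
apply: (@le_trans _ _ (\sum_(i < n.+1) e ^+ 2)).
  apply: ler_sum => i _; rewrite -real_normK ?num_real//.
  by rewrite lerXn2r// nnegrE.
rewrite sumr_const card_ord exprMn -[leLHS]mulr_natl ler_wpM2r ?sqr_ge0//.
by rewrite expr2 ler_peMr// ler1n.
Qed.

Lemma eucl_lt n (v : 'rV[R]_n) e : 0 < e ->
  (forall k, `|v ord0 k| <= e / n.+1%:R) -> eucl v < e.
Proof.
move=> e0 /eucl_le/le_lt_trans; apply.
rewrite mulrCA gtr_pMr// ltr_pdivrMr// mul1r.
by rewrite ltr_nat.
Qed.

Lemma eucl_continuous n : continuous (@eucl R n).
Proof.
move=> v; apply: (@cvg_comp _ _ _
  (fun u : 'rV[R]_n => \sum_(i < n) u ord0 i ^+ 2) (@Num.sqrt R) _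
  (nbhs (\sum_(i < n) v ord0 i ^+ 2))); last exact: sqrt_continuous.
apply: (@cvg_big _ _ _ _ _ _ _ (nbhs v)) => [|i _]; first exact: add_continuous.
have ci := @coord_continuous R 1 n ord0 i v.
exact: (cvgM ci ci).
Qed.

Lemma compact_cube n (r : R) :
  compact [set v : 'rV[R]_n | forall i, `[- r, r]%classic (v ord0 i)].
Proof. by apply: (@rV_compact R n (fun=> `[- r, r]%classic)) => i; exact: segment_compact. Qed.

Lemma cball_cube n j (v : 'rV[R]_n) : cball j v ->
  forall i, `[- j%:R, j%:R]%classic (v ord0 i).
Proof.
move=> vj i; rewrite /= in_itv/= -ler_norml.
exact: le_trans (coord_le_eucl _ _) vj.
Qed.

End EuclideanNorm.

Section Translation.
Context {R : realType}.
Local Notation mu := (@lebesgue_measure R).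

Lemma measurable_shift (t : R) : measurable_fun [set: R] (fun s : R => s + t).
Proof. exact: measurable_funD. Qed.

Lemma preimage_shift_itv (a b t : R) (x y : bool) :
  (fun s => s + t) @^-1` [set` Interval (BSide x a) (BSide y b)] =
  [set` Interval (BSide x (a - t)) (BSide y (b - t))].
Proof.
by apply/seteqP; split => s /=; rewrite !in_itv/= lteifBlDr lteifBrDr.
Qed.

Lemma lebesgue_measure_shift (t : R) (A : set R) : measurable A ->
  pushforward mu ((fun s => s + t) : _ -> measurableTypeR R) A = mu A.
Proof.
move=> mA; apply/esym/lebesgue_measure_unique => //=.
  exact: measurable_shift.
move=> _ _ [[a b]] _ <-.
rewrite /pushforward/= preimage_shift_itv !lebesgue_measure_itv/= !lte_fin.
by rewrite ltrD2r; case: ifP => // _; rewrite -!EFinD; congr EFin; lra.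
Qed.

Lemma ae_shift (t : R) (P : set R) :
  {ae mu, forall s, P s} -> {ae mu, forall s, P (s + t)}.
Proof.
move=> [A [mA A0 PA]]; exists ((fun s => s + t) @^-1` A); split.
- by rewrite -[X in measurable X]setTI; exact: measurable_shift.
- by rewrite -[RHS]A0 -[RHS](lebesgue_measure_shift t mA).
- by move=> s /= nP; apply: PA.
Qed.

Lemma integral_shift (g : R -> R) (a b t : R) :
  mu.-integrable `[a + t, b + t] (EFin \o g) ->
  mu.-integrable `[a, b] (EFin \o (fun s => g (s + t))) /\
  Rintegral mu `[a + t, b + t] g = Rintegral mu `[a, b] (fun s => g (s + t)).
Proof.
set J := `[a + t, b + t]%classic => ig.
have mJ : measurable J by exact: measurable_itv.
have Jab : `[a, b]%classic = (fun s => s + t) @^-1` J.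
  by rewrite preimage_shift_itv !addrK.
pose h : R -> \bar R := (EFin \o g) \_ J.
have mh : measurable_fun setT h.
  by apply/(measurable_restrictT _ mJ); case/integrableP : ig.
have mt := measurable_shift t.
have hg : {in J, h =1 EFin \o g} by move=> x xJ; rewrite /h patchE xJ.
have hgt : {in `[a, b]%classic, h \o (fun s => s + t) =1
    EFin \o (fun s => g (s + t))}.
  by move=> x; rewrite Jab inE => xab; rewrite /= hg// inE.
have shiftE (k : R -> \bar R) :
    (\int[mu]_(x in J) k x =
     \int[pushforward mu ((fun s : R => s + t)%R : _ -> measurableTypeR R)]_(x in J) k x)%E.
  by apply: eq_measure_integral => //= A mA AS; exact/esym/lebesgue_measure_shift.
have ih : mu.-integrable `[a, b] (h \o (fun s => s + t)).
  apply/integrableP; split.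
    by apply: measurable_funTS; apply: measurableT_comp.
  apply: (@le_lt_trans _ _ (\int[mu]_(x in J) (abse \o h) x)%E).
    rewrite shiftE ge0_integral_pushforward// -?Jab//.
      by apply: measurableT_comp => //; exact: measurable_funTS.
    by move=> x _ /=.
  case/integrableP : ig => _; apply: le_lt_trans.
  by rewrite le_eqVlt; apply/orP; left; apply/eqP/eq_integral => x xJ/=; rewrite hg.
split; first by move: ih; apply: eq_integrable => //; exact: measurable_itv.
rewrite /Rintegral; congr fine.
transitivity (\int[mu]_(x in J) h x)%E; first by apply: eq_integral => x xJ; rewrite hg.
rewrite shiftE integral_pushforward//; last by rewrite -Jab.
by rewrite -Jab; apply: eq_integral => x xab; rewrite hgt.
Qed.

End Translation.

Section Rintegral_interval.
Context {R : realType}.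
Local Notation mu := (@lebesgue_measure R).

Lemma Rintegral_itv_split (g : R -> R) (a b c : R) : a <= b -> b <= c ->
  mu.-integrable `[a, c] (EFin \o g) ->
  Rintegral mu `[a, c] g = Rintegral mu `[a, b] g + Rintegral mu `[b, c] g.
Proof.
move=> ab bc ig.
have := @Rintegral_itvB R g (BLeft a) (BRight c) b ig.
rewrite !bnd_simp => /(_ ab bc).
rewrite [X in _ = X]Rintegral_itv_obnd_cbnd; last first.
  by apply: integrableS ig => //; apply: subset_itv; rewrite bnd_simp.
by move=> <-; rewrite addrC subrK.
Qed.

End Rintegral_interval.

Section Borel.

Lemma borel_preimage (T U : topologicalType) (h : T -> U) (B : set U) :
  continuous h -> borel B -> borel (h @^-1` B).
Proof.
move=> ch; move: B; apply: smallest_sub => /=; last first.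
  by move=> A oA; apply: sub_sigma_algebra; move/continuousP : ch; exact.
split => /=.
- by rewrite preimage_set0; exact: sigma_algebra0.
- move=> A bA; rewrite setTD preimage_setC -[X in borel X]setTD.
  exact: sigma_algebraCD.
- by move=> F BF; rewrite preimage_bigcup; apply: sigma_algebra_bigcup.
Qed.

Lemma measurable_borel_preimage (R : realType) (T : topologicalType)
    (h : R -> T) (B : set T) :
  continuous h -> borel B -> measurable (h @^-1` B).
Proof.
move=> ch; move: B; apply: smallest_sub => /=; last first.
  by move=> A oA; apply: open_measurable; move/continuousP : ch; exact.
split => /=.
- by rewrite preimage_set0.
- by move=> A mA; rewrite setTD preimage_setC; exact: measurableC.
- by move=> F mF; rewrite preimage_bigcup; apply: bigcup_measurable => i _; exact: mF.
Qed.

End Borel.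

Section CurveIntegral.
Context {R : realType} {N M : nat}.
Local Notation mu := (@lebesgue_measure R).
Implicit Types (f : fn R N M) (x : R -> 'rV[R]_N) (k : 'I_M).

Definition curve_int f k (a b : R) x : R :=
  Rintegral mu `[a, b] (fun t => f t (x t) ord0 k).

Lemma curve_measurable f k x : C1 f -> continuous x ->
  measurable_fun [set: R] (fun t => f t (x t) ord0 k).
Proof.
move=> C1f cx.
apply: (measurability _ (RGenOInfty.measurableE R)) => // _ [_ [y ->] <-].
rewrite setTI.
pose B := (fun v : 'rV[R]_M => v ord0 k) @^-1` `]y, +oo[%classic.
have bB : borel B.
  apply: sub_sigma_algebra => /=.
  have /continuousP := @coord_continuous R 1 M ord0 k.
  by apply; exact: rray_open.
apply: (@measurable_borel_preimage _ _ (fun t => (t, x t)) _ _ (C1f _ bB)).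
by move=> t; have := cvg_pair (@cvg_id _ (nbhs t)) (cx t); exact.
Qed.

Lemma curve_integrable_bound f k x (m : R -> R) (K : set 'rV[R]_N) a b :
    C1 f -> continuous x -> (forall t, K (x t)) -> L1loc m -> mbound f K m ->
  mu.-integrable `[a, b] (EFin \o (fun t => f t (x t) ord0 k)) /\
  `|curve_int f k a b x| <= Rintegral mu `[a, b] (fun t => `|m t|).
Proof.
move=> C1f cx Kx im [A [mA A0 fA]].
have mab : measurable (`[a, b]%classic : set (measurableTypeR R)) by exact: measurable_itv.
have mf : measurable_fun `[a, b] (EFin \o (fun t => f t (x t) ord0 k)).
  by apply/measurable_EFinP; apply: measurable_funTS; exact: curve_measurable.
have le t : ~ A t -> `|f t (x t) ord0 k| <= `|m t|.
  move=> At; apply: le_trans (ler_norm _).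
  apply: le_trans (coord_le_eucl _ _) _.
  by apply: contrapT => nle; apply: At; apply: fA => /= H; exact: nle (H _ (Kx t)).
have if_ : mu.-integrable `[a, b] (EFin \o (fun t => f t (x t) ord0 k)).
  apply/(negligible_integrable mA) => //.
  have mD : measurable (`[a, b] `\` A : set (measurableTypeR R)) by exact: measurableD.
  have imD : mu.-integrable (`[a, b] `\` A) (EFin \o m).
    by apply: integrableS (im a b).
  apply: le_integrable imD => //; first exact: measurable_funS mf.
  by move=> t [_ At]; rewrite /= lee_fin; exact: le.
split => //.
rewrite /curve_int; apply: (le_trans (le_normr_Rintegral mab if_)).
have im' : mu.-integrable `[a, b] (EFin \o (fun t => `|m t|)).
  exact: (integrable_abse (im a b)).
rewrite /Rintegral fine_le//.
- exact: (integrable_fin_num mab (integrable_abse if_)).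
- exact: (integrable_fin_num mab im').
- apply: ae_ge0_le_integral => //.
  + by case/integrableP : (integrable_abse if_).
  + by case/integrableP : im'.
  exists A; split => // t /= nle; apply: contrapT => At; apply: nle => _.
  by rewrite lee_fin; exact: le.
Qed.

Lemma C2_cball f j : C2 f -> exists m, L1loc m /\ mbound f (cball j) m.
Proof.
move=> /(_ _ (@compact_cube R N j%:R))[m [im fm]]; exists m; split => //.
have [A [mA A0 fA]] := fm; exists A; split => // t /= nP; apply: fA => /= H.
by apply: nP => v /cball_cube; exact: H.
Qed.

Lemma curve_integrable f k x j a b :
    C1 f -> C2 f -> continuous x -> (forall t, cball j (x t)) ->
  mu.-integrable `[a, b] (EFin \o (fun t => f t (x t) ord0 k)).
Proof.
move=> C1f /(@C2_cball _ j)[m [im fm]] cx xj.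
by have [] := curve_integrable_bound k a b C1f cx xj im fm.
Qed.

Lemma L1loc_small_interval (m : R -> R) (r eps : R) : L1loc m -> 0 < eps ->
  exists2 d, 0 < d & forall a b, - r <= a -> a <= b -> b <= r -> b - a < d ->
    Rintegral mu `[a, b] (fun t => `|m t|) < eps.
Proof.
move=> im eps0.
have mrr : measurable (`[- r, r]%classic : set (measurableTypeR R)) by exact: measurable_itv.
have ih : mu.-integrable setT (EFin \o (m \_ `[- r, r])).
  by rewrite -restrict_EFin; apply/integrable_restrict => //; rewrite setTI; exact: im.
have [d [d0 hd]] := integral_normr_continuous ih eps0.
exists d => // a b ra ab br bad.
rewrite [ltLHS](_ : _ = Rintegral mu `[a, b] (fun t => `|(m \_ `[- r, r]) t|)); last first.
  apply: eq_Rintegral.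
  move=> t; rewrite inE/= in_itv/= => /andP[at_ tb]; rewrite patchE mem_set//=.
  by rewrite in_itv/= (le_trans ra)// (le_trans tb).
apply: hd; first exact: measurable_itv.
by rewrite /= lebesgue_measure_itv/= lte_fin; case: ifP => _; rewrite ?lte_fin// -EFinD lte_fin.
Qed.

Lemma curve_int_small f j (r eps : R) : C1 f -> C2 f -> 0 < eps ->
  exists2 d, 0 < d & forall k x a b, continuous x -> (forall t, cball j (x t)) ->
    - r <= a -> a <= b -> b <= r -> b - a < d -> `|curve_int f k a b x| < eps.
Proof.
move=> C1f /(@C2_cball _ j)[m [im fm]] eps0.
have [d d0 hd] := L1loc_small_interval r im eps0.
exists d => // k x a b cx xj ra ab br bad.
have [_ h] := curve_integrable_bound k a b C1f cx xj im fm.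
exact: le_lt_trans h (hd _ _ ra ab br bad).
Qed.

Lemma curve_int_split f k x j a b c : C1 f -> C2 f -> continuous x ->
  (forall t, cball j (x t)) -> a <= b -> b <= c ->
  curve_int f k a c x = curve_int f k a b x + curve_int f k b c x.
Proof.
move=> C1f C2f cx xj ab bc; apply: Rintegral_itv_split => //.
exact: curve_integrable xj.
Qed.

Lemma eq_curve_int f k a b x y : (forall t, a <= t <= b -> x t = y t) ->
  curve_int f k a b x = curve_int f k a b y.
Proof.
move=> xy; apply: eq_Rintegral => t.
by rewrite inE/= in_itv/= => tab; rewrite xy.
Qed.

Lemma C1_shift (t : R) f : C1 f -> C1 (tshift t f).
Proof.
move=> C1f B bB.
apply: (@borel_preimage _ _ (fun p : R * 'rV[R]_N => (p.1 + t, p.2)) _ _ (C1f _ bB)).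
move=> p.
have c1 : (q.1 + t) @[q --> nbhs p] --> p.1 + t.
  by apply: cvgD; [exact: cvg_fst|exact: cvg_cst].
have c2 : q.2 @[q --> nbhs p] --> p.2 by exact: cvg_snd.
exact: (cvg_pair c1 c2).
Qed.

Lemma C2_shift (t : R) f : C2 f -> C2 (tshift t f).
Proof.
move=> C2f K /C2f[m [im fm]]; exists (fun s => m (s + t)); split.
  by move=> a b; have [] := integral_shift (im (a + t) (b + t)).
exact: (ae_shift t fm).
Qed.

Lemma curve_int_shift (t : R) f k x j a b :
  C1 f -> C2 f -> continuous x -> (forall t, cball j (x t)) ->
  curve_int (tshift t f) k a b x =
  curve_int f k (a + t) (b + t) (fun s => x (s - t)).
Proof.
move=> C1f C2f cx xj.
have cx' : continuous (fun s => x (s - t)).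
  move=> s; apply: (@continuous_comp _ _ _ (fun s => s - t) x); last exact: cx.
  by apply: cvgB => //; exact: cvg_cst.
have := curve_integrable k (a + t) (b + t) C1f C2f cx' (fun s => xj (s - t)).
move=> /integral_shift[_]; rewrite /curve_int => ->.
by apply: eq_Rintegral => s _; rewrite addrK.
Qed.

End CurveIntegral.

Section Clamp.
Context {R : realType}.

Definition clamp (a b s : R) : R := Num.max a (Num.min b s).

Lemma clamp_itv a b s : a <= b -> a <= clamp a b s <= b.
Proof. by move=> ab; rewrite /clamp le_max lexx ge_max ab ge_min lexx. Qed.

Lemma clamp_id a b s : a <= s <= b -> clamp a b s = s.
Proof. by move=> /andP[as_ sb]; rewrite /clamp (min_idPr sb) (max_idPr as_). Qed.

Lemma clamp_left a b s : a <= b -> s <= a -> clamp a b s = a.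
Proof.
move=> ab sa; rewrite /clamp (min_idPr (le_trans sa ab)).
exact/max_idPl.
Qed.

Lemma clamp_right a b s : a <= b -> b <= s -> clamp a b s = b.
Proof. by move=> ab bs; rewrite /clamp (min_idPl bs) (max_idPr ab). Qed.

Lemma clamp_lipschitz a b s s' : a <= b ->
  `|clamp a b s - clamp a b s'| <= `|s - s'|.
Proof.
have clampP u : a <= b -> [\/ u <= a /\ clamp a b u = a,
    b <= u /\ clamp a b u = b | a <= u <= b /\ clamp a b u = u].
  move=> ab; have [ua|au] := leP u a; first by constructor 1; rewrite clamp_left.
  have [bu|ub] := leP b u; first by constructor 2; rewrite clamp_right.
  by constructor 3; rewrite clamp_id ?(ltW au) ?(ltW ub).
move=> ab; have [[? ->]|[? ->]|[/andP[? ?] ->]] := clampP s ab;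
  have [[? ->]|[? ->]|[/andP[? ?] ->]] := clampP s' ab;
  rewrite ler_norml; case: (ger0P (s - s')) => ?; apply/andP; split; lra.
Qed.

End Clamp.

Lemma cvg_ultra_compact (T : topologicalType) (I : Type) (U : set_system I)
    (g : I -> T) (A : set T) : UltraFilter U -> compact A ->
  (forall i, A (g i)) -> exists2 p, A p & g @ U --> p.
Proof.
move=> UU cA gA.
have [|p [Ap clp]] := cA (g @ U) (fmap_proper_filter g _).
  by apply: (@filterE _ U _ (g @^-1` A)) => i; exact: gA.
exists p => // B pB; have [//|UB] := in_ultra_setVsetC (g @^-1` B) UU.
have [z [nBz Bz]] := clp (~` B) B UB pB.
by case: nBz.
Qed.

Section Moduli.
Context {R : realType} {N : nat}.
Variable th : Theta R.
Hypothesis sth : suitable_moduli th.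
Implicit Types (j : nat) (q p : rat) (x : R -> 'rV[R]_N).

Lemma modulus_ge0 j q1 q2 u : q1 < q2 -> 0 <= u -> 0 <= th j q1 q2 u.
Proof. by move=> q12; have [_ _ h _] := sth.1 j q1 q2 q12; exact: h. Qed.

Lemma modulus_mono j q1 q2 u v : q1 < q2 -> 0 <= u -> u <= v ->
  th j q1 q2 u <= th j q1 q2 v.
Proof. by move=> q12; have [h _ _ _] := sth.1 j q1 q2 q12; exact: h. Qed.

Lemma modulus_small j q1 q2 (e : R) : q1 < q2 -> 0 < e ->
  exists2 d, 0 < d & forall u, 0 <= u -> u < d -> th j q1 q2 u < e.
Proof.
move=> q12 e0; have [_ ct t0 tz] := sth.1 j q1 q2 q12.
have /subspace_continuousP/(_ 0 (lexx _))/cvgrPdist_lt/(_ _ e0) := ct.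
rewrite /from_subspace/= tz => /nbhs_ballP[d /= d0 hd]; exists d => // u u0 ud.
have := hd u; rewrite /ball/= sub0r normrN ger0_norm// => /(_ ud u0).
by rewrite sub0r normrN ger0_norm// t0.
Qed.

Lemma modulus_continuous j q1 q2 x : q1 < q2 ->
  (forall s t, eucl (x t - x s) <= th j q1 q2 `|t - s|) -> continuous x.
Proof.
move=> q12 xth s; apply/cvg_ballP => e e0.
have [d d0 hd] := modulus_small j q12 e0.
apply/nbhs_ballP; exists d => //= t st; split=> // i k.
rewrite /ball/= ord1; apply: le_lt_trans (hd _ (normr_ge0 (s - t)) st).
apply: le_trans (xth t s); have := coord_le_eucl (x s - x t) k.
by rewrite !mxE.
Qed.

Lemma ratr_le q1 q2 : q1 < q2 -> ratr q1 <= ratr q2 :> R.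
Proof. by move=> /ltW; rewrite ler_rat. Qed.

Definition extend q1 q2 (t : R) x : R -> 'rV[R]_N :=
  fun s => x (clamp (ratr q1) (ratr q2) (s - t)).

Lemma extend_cball j q1 q2 t x s : q1 < q2 -> Kset th j q1 q2 x ->
  cball j (extend q1 q2 t x s).
Proof.
move=> /ratr_le q12 [_ xj _]; apply: xj.
by rewrite /rI/= in_itv/=; exact: clamp_itv.
Qed.

Lemma extend_modulus j q1 q2 (t t' s s' : R) x : q1 < q2 -> Kset th j q1 q2 x ->
  eucl (extend q1 q2 t x s - extend q1 q2 t' x s') <=
  th j q1 q2 `|(s - t) - (s' - t')|.
Proof.
move=> q12 [_ _ xth].
have h u : @rI R q1 q2 (clamp (ratr q1) (ratr q2) u).
  by rewrite /rI/= in_itv/=; apply: clamp_itv; exact: ratr_le.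
apply: le_trans (xth _ _ (h _) (h _)) _.
by apply: modulus_mono => //; apply: clamp_lipschitz; exact: ratr_le.
Qed.

Lemma extend_continuous j q1 q2 t x : q1 < q2 -> Kset th j q1 q2 x ->
  continuous (extend q1 q2 t x).
Proof.
move=> q12 Kx; apply: (modulus_continuous (j := j) q12) => s s'.
have := extend_modulus t t s' s q12 Kx.
by rewrite opprB addrA subrK.
Qed.

Lemma extend_Kset j q1 q2 p1 p2 t x : q1 < q2 -> p1 <= q1 -> q2 <= p2 ->
  Kset th j q1 q2 x -> Kset th j p1 p2 (extend q1 q2 t x).
Proof.
move=> q12 pq1 qp2 Kx; split.
- by apply: continuous_subspaceT; exact: extend_continuous Kx.
- by move=> s _; exact: extend_cball.
- move=> s s' _ _; have := extend_modulus t t s' s q12 Kx.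
  rewrite opprB addrA subrK => /le_trans; apply.
  by apply: (sth.2) => //; exact: le_lt_trans pq1 (lt_le_trans q12 qp2).
Qed.

Lemma extend0_id q1 q2 x s : @rI R q1 q2 s -> extend q1 q2 0 x s = x s.
Proof. by rewrite /rI/= in_itv/= => qs; rewrite /extend subr0 clamp_id. Qed.

Lemma Kset_cst j q1 q2 c : q1 < q2 -> cball j c -> Kset th j q1 q2 (fun=> c : 'rV[R]_N).
Proof.
move=> q12 cj; split => //; first by apply: continuous_subspaceT => ?; exact: cvg_cst.
move=> s t _ _; rewrite subrr.
apply: (@le_trans _ _ (N%:R * 0)); last by rewrite mulr0 modulus_ge0.
by apply: eucl_le => k; rewrite mxE normr0.
Qed.

(* Arzelà-Ascoli along an ultrafilter on [nat]: pointwise limits exist by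
   compactness of the cube, and equicontinuity makes the convergence uniform. *)
Lemma Kset_ascoli j q1 q2 (ys : nat -> R -> 'rV[R]_N) : q1 < q2 ->
  (forall n, Kset th j q1 q2 (ys n)) ->
  exists x (phi : nat -> nat), [/\ Kset th j q1 q2 x, (forall n, n <= phi n)%N &
    forall e, 0 < e -> \forall n \near \oo, forall t, @rI R q1 q2 t ->
      eucl (ys (phi n) t - x t) < e].
Proof.
move=> q12 Ky.
have [U [UU ooU]] := ultraFilterLemma (eventually_filter : ProperFilter \oo).
pose y n := extend q1 q2 0 (ys n).
have cy s : exists l : 'rV[R]_N, (fun n => y n s) @ U --> l.
  have [|l _ yl] := cvg_ultra_compact (g := y ^~ s) UU (@compact_cube R N j%:R).
    by move=> n; apply: cball_cube; exact: extend_cball.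
  by exists l.
have [x xP] := choice cy.
have xj s : cball j (x s).
  apply: (@closed_cvg _ _ U _ (fun n => eucl (y n s)) (fun u : R => u <= j%:R)
    (@closed_le R j%:R) _ (eucl (x s))).
    by apply: filterE => n; exact: (extend_cball 0 s q12 (Ky n)).
  by apply: cvg_comp (xP s) _; exact: eucl_continuous.
have xth s t : eucl (x t - x s) <= th j q1 q2 `|t - s|.
  apply: (@closed_cvg _ _ U _ (fun n => eucl (y n t - y n s))
    (fun u : R => u <= th j q1 q2 `|t - s|) (@closed_le R _) _ (eucl (x t - x s))).
    apply: filterE => n; have := extend_modulus 0 0 t s q12 (Ky n).
    by rewrite !subr0; exact.
  by apply: cvg_comp (cvgB (xP t) (xP s)) _; exact: eucl_continuous.
have Kx : Kset th j q1 q2 x.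
  split => //; apply: continuous_subspaceT.
  exact: modulus_continuous q12 xth.
have uc e : 0 < e -> U [set n | `[ratr q1, ratr q2] `<=` [set s | eucl (y n s - x s) < e]].
  move=> e0; have e30 : 0 < e / N.+1%:R / 3 by rewrite !divr_gt0.
  have [d d0 hd] := modulus_small j q12 e30.
  have /compact_near_coveringP cI := @segment_compact R (ratr q1) (ratr q2).
  apply: cI => s _.
  have /cvg_ballP/(_ _ e30) Us := xP s.
  exists (ball s d, [set n | ball (x s) (e / N.+1%:R / 3) (y n s)]).
    by split => //=; exact: nbhsx_ballx.
  move=> [s' n] /= [ss' [_ xys]]; apply: eucl_lt => // k; rewrite !mxE.
  have h1 := le_lt_trans (xth s' s) (hd _ (normr_ge0 _) ss').
  have h2 := extend_modulus 0 0 s s' q12 (Ky n).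
  rewrite !subr0 in h2.
  have {}h2 := le_lt_trans h2 (hd _ (normr_ge0 _) ss').
  have := coord_le_eucl (x s - x s') k.
  have := coord_le_eucl (y n s - y n s') k.
  have := xys ord0 k; rewrite /ball/= !mxE.
  move: h1 h2; rewrite -[extend q1 q2 0 (ys n)]/(y n).
  move: (eucl (x s - x s')) (eucl (y n s - y n s')) (e / N.+1%:R) => a b E ab bb.
  rewrite !ler_norml !ltr_norml => /andP[? ?] /andP[? ?] /andP[? ?].
  apply/andP; split; lra.
have phiP n : exists m, (n <= m)%N /\ forall s, @rI R q1 q2 s ->
    eucl (ys m s - x s) < n.+1%:R^-1.
  have n0 : 0 < n.+1%:R^-1 :> R by rewrite invr_gt0.
  have [m [nm um]] := filter_ex (filterI (ooU _ (nbhs_infty_ge n)) (uc _ n0)).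
  exists m; split => // s qs; have := um s qs.
  by rewrite /= /y extend0_id.
have [phi hphi] := choice phiP.
exists x, phi; split => //; first by move=> n; have [] := hphi n.
move=> e e0; near=> n => t qt.
have [_ /(_ t qt) h] := hphi n; apply: lt_trans h _.
by near: n; exact: (near_infty_natSinv_lt (PosNum e0)).
Unshelve. all: by end_near. Qed.

End Moduli.

Section UniformContinuity.
Context {R : realType} {N M : nat}.
Variable th : Theta R.
Hypothesis sth : suitable_moduli th.

Lemma condW_curve_int (f : fn R N M) k j q1 q2 xs x :
  condW th f -> q1 < q2 ->
  (forall n, Kset th j q1 q2 (xs n)) -> Kset th j q1 q2 x ->
  (forall e, 0 < e -> \forall n \near \oo,
      forall t, @rI R q1 q2 t -> eucl (xs n t - x t) < e) ->
  forall e, 0 < e -> \forall n \near \oo,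
    `|curve_int f k (ratr q1) (ratr q2) (xs n) -
      curve_int f k (ratr q1) (ratr q2) x| < e.
Proof.
move=> Wf q12 Kxs Kx xsx e e0; have := Wf _ _ _ q12 _ _ Kxs Kx xsx e e0.
apply: filterS => n; apply: le_lt_trans.
set v := (v in eucl v); have := coord_le_eucl v k.
by rewrite /v !mxE.
Qed.

Lemma curve_int_uniform_continuous (f : fn R N M) j q1 q2 (eps : R) :
  condW th f -> q1 < q2 -> 0 < eps ->
  exists2 d, 0 < d & forall x y, Kset th j q1 q2 x -> Kset th j q1 q2 y ->
    (forall t, @rI R q1 q2 t -> eucl (x t - y t) < d) -> forall k,
    `|curve_int f k (ratr q1) (ratr q2) x -
      curve_int f k (ratr q1) (ratr q2) y| < eps.
Proof.
move=> Wf q12 eps0; apply: contrapT => H.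
have {}H n : exists z : (R -> 'rV[R]_N) * (R -> 'rV[R]_N) * 'I_M,
    [/\ Kset th j q1 q2 z.1.1, Kset th j q1 q2 z.1.2,
     (forall t, @rI R q1 q2 t -> eucl (z.1.1 t - z.1.2 t) < n.+1%:R^-1) &
     eps <= `|curve_int f z.2 (ratr q1) (ratr q2) z.1.1 -
      curve_int f z.2 (ratr q1) (ratr q2) z.1.2|].
  apply: contrapT => nex; apply: H; exists (n.+1%:R^-1); first by rewrite invr_gt0.
  move=> x y Kx Ky xy k; rewrite ltNge; apply/negP => le; apply: nex.
  by exists (x, y, k).
have [z hz] := choice H.
have [|x [phi [Kx phin cx]]] := @Kset_ascoli R N th sth j q1 q2 (fun n => (z n).1.1) q12.
  by move=> n; have [] := hz n.
have cy e : 0 < e -> \forall n \near \oo, forall t, @rI R q1 q2 t ->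
    eucl ((z (phi n)).1.2 t - x t) < e.
  move=> e0; have e20 : 0 < e / N.+1%:R / 2 by rewrite !divr_gt0.
  have c1 := cx _ e20.
  have c2 := near_infty_natSinv_lt (PosNum e20).
  near=> n => t qt; apply: eucl_lt => // k'.
  have h1 : eucl ((z (phi n)).1.1 t - x t) < e / N.+1%:R / 2.
    by move: t qt; near: n.
  have h2 : eucl ((z (phi n)).1.1 t - (z (phi n)).1.2 t) < e / N.+1%:R / 2.
    have [_ _ h _] := hz (phi n); apply: lt_trans (h t qt) _.
    apply: (@le_lt_trans _ _ (n.+1%:R^-1)); last by near: n.
    by rewrite lef_pV2 ?posrE// ler_nat ltnS.
  have := coord_le_eucl ((z (phi n)).1.1 t - x t) k'.
  have := coord_le_eucl ((z (phi n)).1.1 t - (z (phi n)).1.2 t) k'.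
  rewrite !mxE; move: h1 h2; move: (eucl _) (eucl _) (e / N.+1%:R) => a b E ab bb.
  rewrite !ler_norml => /andP[? ?] /andP[? ?].
  apply/andP; split; lra.
have e20 : 0 < eps / 2 by rewrite divr_gt0.
have W1 k := condW_curve_int k Wf q12 (fun n => let: And4 h _ _ _ := hz (phi n) in h) Kx cx e20.
have W2 k := condW_curve_int k Wf q12 (fun n => let: And4 _ h _ _ := hz (phi n) in h) Kx cy e20.
have [n [/(_ (z (phi n)).2) w1 /(_ (z (phi n)).2) w2]] :=
  filter_ex (filterI (filter_forall _ W1) (filter_forall _ W2)).
have [_ _ _] := hz (phi n).
move: w1 w2; rewrite leNgt => w1 w2 /negP; apply.
rewrite !ltr_norml in w1 w2 *; move: w1 w2 => /andP[? ?] /andP[? ?].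
by apply/andP; split; lra.
Unshelve. all: by end_near. Qed.

End UniformContinuity.

Section ShiftIntegral.
Context {R : realType} {N M : nat}.
Variable th : Theta R.
Hypothesis sth : suitable_moduli th.
Implicit Types (f g : fn R N M) (k : 'I_M) (j : nat) (q p : rat).

Lemma rat_below (a : R) : exists p, ratr p < a.
Proof.
have [|p] := @rat_in_itvoo R (a - 1) a; first by rewrite ltrBlDr ltrDl.
by rewrite in_itv/= => /andP[_ pa]; exists p.
Qed.

Lemma rat_above (a : R) : exists p, a < ratr p.
Proof.
have [|p] := @rat_in_itvoo R a (a + 1); first by rewrite ltrDl.
by rewrite in_itv/= => /andP[pa _]; exists p.
Qed.

Lemma rat_inner_segment (a b d : R) : a < b -> 0 < d ->
  exists p1 p2, [/\ p1 < p2, a < ratr p1 < a + d & b - d < ratr p2 < b].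
Proof.
move=> ab d0; pose m := Num.min d ((b - a) / 2).
have m0 : 0 < m by rewrite lt_min d0/= divr_gt0// subr_gt0.
have [md mab] : m <= d /\ m <= (b - a) / 2 by rewrite !ge_min !lexx orbT.
have [|p1] := @rat_in_itvoo R a (a + m); first by rewrite ltrDl.
rewrite in_itv/= => /andP[ap1 p1m].
have [|p2] := @rat_in_itvoo R (b - m) b; first by rewrite ltrBlDr ltrDl.
rewrite in_itv/= => /andP[bp2 p2b].
exists p1, p2; split; [rewrite -(ltr_rat R)|apply/andP; split|apply/andP; split]; lra.
Qed.

Lemma curve_int_extend0 f k q1 q2 (x : R -> 'rV[R]_N) :
  curve_int f k (ratr q1) (ratr q2) x =
  curve_int f k (ratr q1) (ratr q2) (extend q1 q2 0 x).
Proof. by apply: eq_curve_int => t qt; rewrite extend0_id//= in_itv. Qed.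

(* Beyond the translated segment the extended curve is constant; this is how
   an integral over a segment with real endpoints is reduced to [condW]. *)
Lemma curve_int_tshift f k j q1 q2 p1 p2 t x : C1 f -> C2 f ->
  q1 < q2 -> Kset th j q1 q2 x ->
  ratr p1 <= ratr q1 + t -> ratr q2 + t <= ratr p2 ->
  curve_int (tshift t f) k (ratr q1) (ratr q2) x =
  curve_int f k (ratr p1) (ratr p2) (extend q1 q2 t x)
  - curve_int f k (ratr p1) (ratr q1 + t) (fun=> x (ratr q1))
  - curve_int f k (ratr q2 + t) (ratr p2) (fun=> x (ratr q2)).
Proof.
move=> C1f C2f q12 Kx pq1 qp2; have q12R := ratr_le (R := R) q12.
have cE s := @extend_continuous R N th sth j q1 q2 s x q12 Kx.
have bE s u := extend_cball s u q12 Kx.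
rewrite curve_int_extend0 (curve_int_shift t k _ _ C1f C2f (cE 0) (bE 0)).
rewrite (eq_curve_int _ _ (y := extend q1 q2 t x)); last first.
  by move=> s _; rewrite /extend subr0.
rewrite (eq_curve_int (a := ratr p1) (b := ratr q1 + t) _ _ (y := extend q1 q2 t x)); last first.
  by move=> s /andP[_ st]; rewrite /extend clamp_left// lerBlDr.
rewrite (eq_curve_int (a := ratr q2 + t) (b := ratr p2) _ _ (y := extend q1 q2 t x)); last first.
  by move=> s /andP[st _]; rewrite /extend clamp_right// lerBrDr.
rewrite (curve_int_split (c := ratr p2) k C1f C2f (cE t) (bE t) pq1); last first.
  by apply: le_trans qp2; rewrite lerD2r.
have q12t : ratr q1 + t <= ratr q2 + t by rewrite lerD2r.
by rewrite (curve_int_split k C1f C2f (cE t) (bE t) q12t qp2); lra.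
Qed.

Lemma cst_curve_int_small f j (r eps : R) : C1 f -> C2 f -> 0 < eps ->
  exists2 d, 0 < d & forall k c a b, cball j c ->
    - r <= a -> a <= b -> b <= r -> b - a < d -> `|curve_int f k a b (fun=> c)| < eps.
Proof.
move=> C1f C2f eps0; have [d d0 hd] := curve_int_small j r C1f C2f eps0.
exists d => // k c a b cj ra ab br bad; apply: hd => //.
by move=> s; exact: cvg_cst.
Qed.

Lemma cst_curve_int_split f k j c a b1 b2 d : C1 f -> C2 f -> cball j c ->
  a <= b1 -> b1 <= b2 -> b2 <= d ->
  curve_int f k a d (fun=> c) = curve_int f k a b1 (fun=> c)
    + curve_int f k b1 b2 (fun=> c) + curve_int f k b2 d (fun=> c).
Proof.
move=> C1f C2f cj ab bb bd.
have cc : continuous ((fun=> c) : R -> 'rV[R]_N) by move=> s; exact: cvg_cst.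
rewrite (curve_int_split k C1f C2f cc (fun=> cj) ab (le_trans bb bd)).
by rewrite (curve_int_split k C1f C2f cc (fun=> cj) bb bd) addrA.
Qed.

Lemma norm_sub3_lt (a1 b1 c1 a2 b2 c2 e : R) :
  `|a1| < e / 5 -> `|c1| < e / 5 -> `|a2| < e / 5 -> `|c2| < e / 5 ->
  `|b1 - b2| < e / 5 -> `|a1 + b1 + c1 - (a2 + b2 + c2)| < e.
Proof.
rewrite !ltr_norml.
move=> /andP[? ?] /andP[? ?] /andP[? ?] /andP[? ?] /andP[? ?].
by apply/andP; split; lra.
Qed.

Lemma norm_sub3_le (a1 a2 a3 b1 b2 b3 c e : R) :
  `|a1 - c| < e -> `|c - b1| < e -> `|a2 - b2| < e -> `|a3 - b3| < e ->
  `|a1 - a2 - a3 - (b1 - b2 - b3)| <= 4 * e.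
Proof.
rewrite !ltr_norml ler_norml.
move=> /andP[? ?] /andP[? ?] /andP[? ?] /andP[? ?].
by apply/andP; split; lra.
Qed.

Lemma condW_cst f k j (cs : nat -> 'rV[R]_N) c (a b : R) : WTC th f ->
  (forall n, cball j (cs n)) -> cball j c ->
  (forall e, 0 < e -> \forall n \near \oo, eucl (cs n - c) < e) -> a < b ->
  forall e, 0 < e -> \forall n \near \oo,
    `|curve_int f k a b (fun=> cs n) - curve_int f k a b (fun=> c)| < e.
Proof.
move=> [C1f C2f Wf] csj cj csc ab e e0.
have e50 : 0 < e / 5 by rewrite divr_gt0.
have [d d0 hd] := cst_curve_int_small j (`|a| + `|b|) C1f C2f e50.
have [p1 [p2 [p12 /andP[ap1 p1a] /andP[bp2 p2b]]]] := rat_inner_segment ab d0.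
have p12R := ratr_le (R := R) p12.
have cb : forall e, 0 < e -> \forall n \near \oo,
    forall t, @rI R p1 p2 t -> eucl ((fun=> cs n) t - (fun=> c) t) < e.
  by move=> e1 e10; apply: filterS (csc _ e10) => n h t _.
have := condW_curve_int k Wf p12 (fun n => Kset_cst sth p12 (csj n))
  (Kset_cst sth p12 cj) cb e50.
apply: filterS => n W.
have ha := ler_norm a; have hb := ler_norm b.
have ha' : - a <= `|a| by rewrite -normrN ler_norm.
have hb' : - b <= `|b| by rewrite -normrN ler_norm.
have h u v c' : cball j c' -> a <= u -> u <= v -> v <= b -> v - u < d ->
    `|curve_int f k u v (fun=> c')| < e / 5.
  by move=> *; apply: hd => //; lra.
have h1 : `|curve_int f k a (ratr p1) (fun=> cs n)| < e / 5 by apply: h => //; lra.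
have h2 : `|curve_int f k a (ratr p1) (fun=> c)| < e / 5 by apply: h => //; lra.
have h3 : `|curve_int f k (ratr p2) b (fun=> cs n)| < e / 5 by apply: h => //; lra.
have h4 : `|curve_int f k (ratr p2) b (fun=> c)| < e / 5 by apply: h => //; lra.
rewrite (cst_curve_int_split k C1f C2f (csj n) (ltW ap1) p12R (ltW p2b)).
rewrite (cst_curve_int_split k C1f C2f cj (ltW ap1) p12R (ltW p2b)).
exact: norm_sub3_lt.
Qed.

Lemma WTC_tshift (t : R) f : WTC th f -> WTC th (tshift t f).
Proof.
move=> wf; have [C1f C2f Wf] := wf.
split; [exact: C1_shift|exact: C2_shift|].
move=> j q1 q2 q12 xs x Kxs Kx xsx e e0.
have [p1 hp1] := rat_below (Num.min (ratr q1) (ratr q1 + t)).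
have [p2 hp2] := rat_above (Num.max (ratr q2) (ratr q2 + t)).
move: hp1 hp2; rewrite lt_min gt_max !ltr_rat => /andP[p1q1 p1q1t] /andP[q2p2 q2tp2].
have p12 : p1 < p2 by exact: lt_trans p1q1 (lt_trans q12 q2p2).
have e30 : 0 < e / M.+1%:R / 3 by rewrite !divr_gt0.
have q1I : @rI R q1 q2 (ratr q1) by rewrite /rI/= in_itv/= lexx ratr_le.
have q2I : @rI R q1 q2 (ratr q2) by rewrite /rI/= in_itv/= lexx ratr_le.
have cst_cvg u : @rI R q1 q2 u ->
    forall e, 0 < e -> \forall n \near \oo, eucl (xs n u - x u) < e.
  by move=> qu e1 e10; apply: filterS (xsx _ e10) => n; exact.
have bx u (y : R -> 'rV[R]_N) : Kset th j q1 q2 y -> @rI R q1 q2 u -> cball j (y u).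
  by move=> [_ h _]; exact: h.
have w1 k := condW_curve_int k Wf p12
  (fun n => extend_Kset sth t q12 (ltW p1q1) (ltW q2p2) (Kxs n))
  (extend_Kset sth t q12 (ltW p1q1) (ltW q2p2) Kx) _ e30.
have w2 k := condW_cst k wf (fun n => bx _ _ (Kxs n) q1I) (bx _ _ Kx q1I)
  (cst_cvg _ q1I) p1q1t e30.
have w3 k := condW_cst k wf (fun n => bx _ _ (Kxs n) q2I) (bx _ _ Kx q2I)
  (cst_cvg _ q2I) q2tp2 e30.
have ext_cvg e' : 0 < e' -> \forall n \near \oo, forall s, @rI R p1 p2 s ->
    eucl (extend q1 q2 t (xs n) s - extend q1 q2 t x s) < e'.
  move=> e10; apply: filterS (xsx _ e10) => n h s _; apply: h.
  by rewrite /rI/= in_itv/=; apply: clamp_itv; exact: ratr_le.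
have [n1 _ {}w1] := filter_forall _ (w1 ext_cvg).
have [n2 _ {}w2] := filter_forall _ w2.
have [n3 _ {}w3] := filter_forall _ w3.
exists (maxn n1 (maxn n2 n3)) => // n; rewrite /= !geq_max => /and3P[l1 l2 l3].
apply: eucl_lt => // k; rewrite !mxE.
have E y (Ky : Kset th j q1 q2 y) :=
  curve_int_tshift k C1f C2f q12 Ky (ltW p1q1t) (ltW q2tp2).
rewrite [X in `|X - _|](E _ (Kxs n)) [X in `|_ - X|](E _ Kx).
move: (w1 n l1 k) (w2 n l2 k) (w3 n l3 k) => /=.
move: (curve_int _ _ _ _ _) (curve_int _ _ _ _ _) (curve_int _ _ _ _ _).
move: (curve_int _ _ _ _ _) (curve_int _ _ _ _ _) (curve_int _ _ _ _ _).
move: (e / M.+1%:R) => e' a1 a2 a3 a4 a5 a6.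
rewrite !ltr_norml ler_norml => /andP[? ?] /andP[? ?] /andP[? ?].
by apply/andP; split; lra.
Qed.

End ShiftIntegral.

Section ShiftContinuity.
Context {R : realType} {N M : nat}.
Variable th : Theta R.
Hypothesis sth : suitable_moduli th.
Implicit Types (f g : fn R N M) (k : 'I_M) (j : nat) (q p : rat).

Lemma curve_intB f g k j q1 q2 x : C1 f -> C2 f -> C1 g -> C2 g ->
  q1 < q2 -> Kset th j q1 q2 x ->
  curve_int (fun t x => g t x - f t x) k (ratr q1) (ratr q2) x =
  curve_int g k (ratr q1) (ratr q2) x - curve_int f k (ratr q1) (ratr q2) x.
Proof.
move=> C1f C2f C1g C2g q12 Kx.
have cE := @extend_continuous R N th sth j q1 q2 0 x q12 Kx.
have bE u := extend_cball 0 u q12 Kx.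
rewrite curve_int_extend0 (curve_int_extend0 g) (curve_int_extend0 f) /curve_int -RintegralB//; last 2 first.
- exact: (curve_integrable k _ _ C1g C2g cE bE).
- exact: (curve_integrable k _ _ C1f C2f cE bE).
by apply: eq_Rintegral => t _; rewrite !mxE.
Qed.

Lemma pIj_lt_curve_int f g k j q1 q2 (eps : R) x :
  C1 f -> C2 f -> C1 g -> C2 g -> q1 < q2 ->
  (pIj th j q1 q2 (fun t x => (g t x - f t x)%R) < eps%:E)%O -> Kset th j q1 q2 x ->
  `|curve_int g k (ratr q1) (ratr q2) x - curve_int f k (ratr q1) (ratr q2) x| < eps.
Proof.
move=> C1f C2f C1g C2g q12 pgf Kx; rewrite -(curve_intB k C1f C2f C1g C2g q12 Kx).
rewrite -lte_fin; apply: le_lt_trans pgf.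
set v := vint (ratr q1) (ratr q2) (fun t => g t (x t) - f t (x t)).
apply: (@le_trans _ _ (eucl v)%:E).
  by rewrite lee_fin; have := coord_le_eucl v k; rewrite /v mxE.
by apply: ereal_sup_ubound; exists x.
Qed.

Lemma curve_int_pIj_lt f g j q1 q2 (eps : R) :
  C1 f -> C2 f -> C1 g -> C2 g -> q1 < q2 -> 0 < eps ->
  (forall x k, Kset th j q1 q2 x ->
    `|curve_int g k (ratr q1) (ratr q2) x - curve_int f k (ratr q1) (ratr q2) x|
      <= eps / 2 / M.+1%:R) ->
  (pIj th j q1 q2 (fun t x => (g t x - f t x)%R) < eps%:E)%O.
Proof.
move=> C1f C2f C1g C2g q12 eps0 H.
apply: (@le_lt_trans _ _ (eps / 2)%:E); last by rewrite lte_fin; lra.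
apply: ge_ereal_sup => _ [x Kx <-]; rewrite lee_fin; apply: ltW.
apply: eucl_lt; first by rewrite divr_gt0.
by move=> k; rewrite mxE; have := H x k Kx; rewrite -(curve_intB k C1f C2f C1g C2g q12 Kx).
Qed.

Lemma snear_refl F (eps : R) f : C1 f -> C2 f -> 0 < eps -> snear th F eps f f.
Proof.
move=> C1f C2f eps0 i _ q12; apply: curve_int_pIj_lt => // x k _.
by rewrite subrr normr0 !divr_ge0// ltW.
Qed.

Lemma snear_mono F F' (eps eps' : R) f g : {subset F' <= F} -> eps <= eps' ->
  snear th F eps f g -> snear th F' eps' f g.
Proof.
move=> FF le fg i iF' q12; apply: lt_le_trans (fg i (FF _ iF') q12) _.
by rewrite lee_fin.
Qed.

Lemma sclosure_sub (E : set (fn R N M)) f : (forall g, E g -> WTC th g) ->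
  E f -> sclosure th E f.
Proof.
move=> EW Ef; have wf := EW f Ef; have [C1f C2f _] := wf.
by split => // F eps eps0; exists f => //; exact: snear_refl.
Qed.

(* The uniform m-bounds of [E] do not obviously pass to its closure, but the
   resulting bound on integrals of constant curves does, and it is all that
   continuity of the shift needs. *)
Lemma sclosure_cst_small (E : set (fn R N M)) j (r eps : R) :
  (forall f, E f -> WTC th f) -> equicont_mbounds E -> 0 < r -> 0 < eps ->
  exists2 d, 0 < d & forall f k c a b, sclosure th E f -> cball j c ->
    - r <= a -> a <= b -> b <= r -> b - a < d -> `|curve_int f k a b (fun=> c)| < eps.
Proof.
move=> EW /(_ j)[mb [mbP mbE]] r0 eps0.
have e50 : 0 < eps / 5 by rewrite divr_gt0.
have [d d0 hd] := mbE r _ r0 e50.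
exists d => // f k c a b [[C1f C2f _] clf] cj ra ab br bad.
have [d' d'0 hd'] := cst_curve_int_small j r C1f C2f e50.
move: ab; rewrite le_eqVlt => /predU1P[ab|ab].
  by rewrite ab /curve_int set_itv1 Rintegral_set1 normr0.
have [p1 [p2 [p12 /andP[ap1 p1a] /andP[bp2 p2b]]]] := rat_inner_segment ab d'0.
have p12R := ratr_le (R := R) p12.
rewrite (cst_curve_int_split k C1f C2f cj (ltW ap1) p12R (ltW p2b)).
have h1 : `|curve_int f k a (ratr p1) (fun=> c)| < eps / 5.
  by apply: hd' => //; lra.
have h2 : `|curve_int f k (ratr p2) b (fun=> c)| < eps / 5.
  by apply: hd' => //; lra.
have [e Ee nfe] := clf [:: (j, p1, p2)] _ e50.
have [C1e C2e _] := EW e Ee.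
have [ie e0 be] := mbP e Ee.
have cc : continuous ((fun=> c) : R -> 'rV[R]_N) by move=> s; exact: cvg_cst.
have [_ h3] := curve_integrable_bound k (ratr p1) (ratr p2) C1e cc (fun=> cj) ie be.
have h4 : Rintegral (@lebesgue_measure R) `[ratr p1, ratr p2] (fun t => `|mb e t|) < eps / 5.
  rewrite (_ : (fun t => `|mb e t|) = mb e); last by apply/funext => t; rewrite ger0_norm.
  by apply: (hd e Ee) => //; lra.
have h5 := pIj_lt_curve_int k C1f C2f C1e C2e p12
  (nfe _ (mem_head _ _) p12) (Kset_cst sth p12 cj).
have {}h3 := le_lt_trans h3 h4.
move: h1 h2 h3 h5; rewrite /= !ltr_norml.
move=> /andP[? ?] /andP[? ?] /andP[? ?] /andP[? ?].
by apply/andP; split; lra.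
Qed.

Section Closure.
Variable E : set (fn R N M).
Hypothesis EW : forall f, E f -> WTC th f.
Hypothesis Em : equicont_mbounds E.
Local Notation D := (sclosure th E).

Lemma cst_curve_int_joint_continuous f0 j (a0 b0 eps : R) : D f0 -> a0 < b0 -> 0 < eps ->
  exists (d : R) i, 0 < d /\ forall f, D f -> snear th [:: i] (eps / 5) f0 f ->
    forall k c a b, cball j c -> `|a - a0| < d -> `|b - b0| < d ->
    `|curve_int f k a b (fun=> c) - curve_int f0 k a0 b0 (fun=> c)| < eps.
Proof.
move=> Df0 ab eps0.
have e50 : 0 < eps / 5 by rewrite divr_gt0.
have r0 : 0 < `|a0| + `|b0| + 1 by rewrite ltr_wpDl// addr_ge0.
have [d0 d00 hd] := sclosure_cst_small j EW Em r0 e50.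
pose d := Num.min 1 (Num.min (d0 / 3) ((b0 - a0) / 8)).
have dpos : 0 < d by rewrite !lt_min ltr01/= !divr_gt0// subr_gt0.
have [dle1 [dled dleab]] : d <= 1 /\ d <= d0 / 3 /\ d <= (b0 - a0) / 8.
  by rewrite !ge_min !lexx !orbT.
have [|p1] := @rat_in_itvoo R (a0 + d) (a0 + 2 * d); first lra.
rewrite in_itv/= => /andP[ap1 p1a].
have [|p2] := @rat_in_itvoo R (b0 - 2 * d) (b0 - d); first lra.
rewrite in_itv/= => /andP[bp2 p2b].
have p12R : ratr p1 < ratr p2 :> R by lra.
have p12 : p1 < p2 by rewrite -(ltr_rat R).
have ha := ler_norm a0; have hb := ler_norm b0.
have ha' : - a0 <= `|a0| by rewrite -normrN ler_norm.
have hb' : - b0 <= `|b0| by rewrite -normrN ler_norm.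
exists d, (j, p1, p2); split => // f Df nf k c a b cj da db.
move: da db; rewrite ![`|_ - _| < d]ltr_distl => /andP[aa0 a0a] /andP[bb0 b0b].
have [[C1f C2f _] _] := Df; have [[C1f0 C2f0 _] _] := Df0.
have hD g u v : D g -> a0 - d <= u -> u <= v -> v <= b0 + d -> v - u < d0 ->
    `|curve_int g k u v (fun=> c)| < eps / 5.
  move=> Dg hu huv hv hvu.
  apply: hd => //; clear -hu hv ha hb ha' hb' dle1 ab; lra.
have ap : a <= ratr p1 by clear -ap1 a0a; lra.
have pb : ratr p2 <= b by clear -p2b bb0; lra.
have ap0 : a0 <= ratr p1 by clear -ap1 dpos; lra.
have pb0 : ratr p2 <= b0 by clear -p2b dpos; lra.
rewrite (cst_curve_int_split k C1f C2f cj ap (ltW p12R) pb).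
rewrite (cst_curve_int_split k C1f0 C2f0 cj ap0 (ltW p12R) pb0).
apply: norm_sub3_lt; last first.
- exact: (pIj_lt_curve_int k C1f0 C2f0 C1f C2f p12 (nf _ (mem_head _ _) p12)
    (Kset_cst sth p12 cj)).
all: apply: hD => //; clear - ap pb ap0 pb0 aa0 a0a bb0 b0b ap1 p1a bp2 p2b dled dpos ab p12R; lra.
Qed.

Lemma shift_continuous_seminorm t0 f0 (i : idx) (eps : R) : D f0 -> 0 < eps ->
  exists (d : R) (F' : seq idx) (eta : R), [/\ 0 < d, 0 < eta &
    forall t f, D f -> `|t - t0| < d -> snear th F' eta f0 f ->
      snear th [:: i] eps (tshift t0 f0) (tshift t f)].
Proof.
move=> Df0 eps0; case: i => [[j q1] q2].
have [q12|nq12] := boolP (q1 < q2); last first.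
  exists 1, [::], 1; split => // t f _ _ _ i; rewrite inE => /eqP -> /= q12.
  by rewrite q12 in nq12.
have [[C1f0 C2f0 Wf0] _] := Df0.
have [e e0 epsE] : exists2 e, 0 < e & eps / 2 / M.+1%:R = 4 * e.
  exists (eps / 2 / M.+1%:R / 4); first by rewrite !divr_gt0.
  by rewrite [RHS]mulrC divfK.
have [p1 hp1] := rat_below (Num.min (ratr q1) (ratr q1 + t0 - 1)).
have [p2 hp2] := rat_above (Num.max (ratr q2) (ratr q2 + t0 + 1)).
move: hp1 hp2; rewrite lt_min gt_max !ltr_rat => /andP[p1q1 p1q1t] /andP[q2p2 q2tp2].
have p12 : p1 < p2 by exact: lt_trans p1q1 (lt_trans q12 q2p2).
have l1 : ratr p1 < ratr q1 + t0 by apply: lt_trans p1q1t _; rewrite ltrBlDr ltrDl.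
have l2 : ratr q2 + t0 < ratr p2 by apply: lt_trans q2tp2; rewrite ltrDl.
have [d1 [i1 [d10 H1]]] := cst_curve_int_joint_continuous j Df0 l1 e0.
have [d2 [i2 [d20 H2]]] := cst_curve_int_joint_continuous j Df0 l2 e0.
have [d3 d30 H3] := curve_int_uniform_continuous sth j Wf0 p12 e0.
have [d4 d40 H4] := modulus_small sth j q12 d30.
exists (Num.min 1 (Num.min d1 (Num.min d2 d4))), [:: (j, p1, p2); i1; i2], (e / 5).
split; [by rewrite !lt_min ltr01 d10 d20 d40|by rewrite divr_gt0|].
move=> t f Df; rewrite !lt_min => /and4P[t1 td1 td2 td4] nf.
have [[C1f C2f _] _] := Df.
move=> i; rewrite inE => /eqP -> _ /=.
apply: curve_int_pIj_lt => //; try exact: C1_shift; try exact: C2_shift.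
move=> x k Kx.
have := t1; rewrite ltr_distl => /andP[tlo thi].
have m1 : ratr p1 <= ratr q1 + t by clear -p1q1t tlo; lra.
have m2 : ratr q2 + t <= ratr p2 by clear -q2tp2 thi; lra.
rewrite (curve_int_tshift sth k C1f C2f q12 Kx m1 m2).
rewrite (curve_int_tshift sth k C1f0 C2f0 q12 Kx (ltW l1) (ltW l2)).
have KE s := extend_Kset sth s q12 (ltW p1q1) (ltW q2p2) Kx.
have bx u : @rI R q1 q2 u -> cball j (x u) by case: Kx => _ + _; exact.
have q1I : @rI R q1 q2 (ratr q1) by rewrite /rI/= in_itv/= lexx ratr_le.
have q2I : @rI R q1 q2 (ratr q2) by rewrite /rI/= in_itv/= lexx ratr_le.
have nf' i' : i' \in [:: (j, p1, p2); i1; i2] -> snear th [:: i'] (e / 5) f0 f.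
  by move=> ii'; apply: snear_mono nf => // i''; rewrite inE => /eqP ->.
have A : `|curve_int f k (ratr p1) (ratr p2) (extend q1 q2 t x) -
           curve_int f0 k (ratr p1) (ratr p2) (extend q1 q2 t x)| < e.
  apply: (@lt_trans _ _ (e / 5)); last by rewrite ltr_pdivrMr// ltr_pMr// ltr1n.
  apply: (pIj_lt_curve_int k C1f0 C2f0 C1f C2f p12 _ (KE t)).
  by have /(_ _ (mem_head _ _) p12) := nf' (j, p1, p2) (mem_head _ _).
have B : `|curve_int f0 k (ratr p1) (ratr p2) (extend q1 q2 t x) -
           curve_int f0 k (ratr p1) (ratr p2) (extend q1 q2 t0 x)| < e.
  apply: H3 => // s _; apply: le_lt_trans (extend_modulus sth t t0 s s q12 Kx) _.
  apply: H4 => //; apply: le_lt_trans td4.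
  by rewrite opprB addrC addrA subrK distrC.
have C := H1 f Df (nf' i1 _) k (x (ratr q1)) (ratr p1) (ratr q1 + t) (bx _ q1I).
have D' := H2 f Df (nf' i2 _) k (x (ratr q2)) (ratr q2 + t) (ratr p2) (bx _ q2I).
have {}C : `|curve_int f k (ratr p1) (ratr q1 + t) (fun=> x (ratr q1)) -
    curve_int f0 k (ratr p1) (ratr q1 + t0) (fun=> x (ratr q1))| < e.
  apply: C; first by rewrite !inE eqxx orbT.
    by rewrite subrr normr0.
  by rewrite opprD addrACA subrr add0r.
have {}D' : `|curve_int f k (ratr q2 + t) (ratr p2) (fun=> x (ratr q2)) -
    curve_int f0 k (ratr q2 + t0) (ratr p2) (fun=> x (ratr q2))| < e.
  apply: D'; first by rewrite !inE eqxx !orbT.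
    by rewrite opprD addrACA subrr add0r.
  by rewrite subrr normr0.
rewrite epsE; exact: norm_sub3_le A B C D'.
Qed.

Lemma sclosure_shift_continuous : shift_continuous_on th D.
Proof.
move=> t0 f0 Df0 F eps eps0; elim: F => [|i F [d [F' [eta [d0 eta0 H]]]]].
  by exists 1, [::], 1; split.
have [d1 [F1 [eta1 [d10 eta10 H1]]]] := shift_continuous_seminorm t0 i Df0 eps0.
exists (Num.min d d1), (F' ++ F1), (Num.min eta eta1).
split; [by rewrite lt_min d0|by rewrite lt_min eta0|].
move=> t f Df; rewrite lt_min => /andP[td td1] nf i'.
rewrite inE => /predU1P[->|i'F] q12.
  apply: (H1 t f Df td1 _ i (mem_head _ _) q12).
  apply: snear_mono nf; last by rewrite ge_min lexx orbT.
  by move=> u uF; rewrite mem_cat uF orbT.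
apply: (H t f Df td _ i' i'F q12).
apply: snear_mono nf; last by rewrite ge_min lexx.
by move=> u uF; rewrite mem_cat uF.
Qed.

End Closure.

End ShiftContinuity.

Theorem theorem3p1 (R : realType) (N M : nat) (th : Theta R)
    (E : set (fn R N M)) :
  suitable_moduli th ->
  (forall f, E f -> WTC th f) ->
  equicont_mbounds E ->
  [/\ (forall (t : R) f, sclosure th E f -> WTC th (tshift t f)),
      shift_continuous_on th (sclosure th E) &
      (forall f : fn R N M, WTC th f ->
         equicont_mbounds (range (fun t : R => tshift t f)) ->
         let H := sclosure th (range (fun t : R => tshift t f)) in
         [/\ (forall (t : R) g, H g -> H (tshift t g)),
             (forall g, H g -> tshift 0 g = g),
             (forall (s t : R) g, H g -> tshift (s + t) g = tshift t (tshift s g)) &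
             shift_continuous_on th H])].
Proof.
move=> sth EW Em; split.
- by move=> t f [wf _]; exact: WTC_tshift.
- exact: sclosure_shift_continuous.
move=> f wf fm H.
have tshiftD (s t : R) (g : fn R N M) : tshift (s + t) g = tshift t (tshift s g).
  by apply/funext => u; rewrite /tshift -addrA [t + s]addrC.
have orbitW g : range (fun t : R => tshift t f) g -> WTC th g.
  by move=> [t _ <-]; exact: WTC_tshift.
have cH : shift_continuous_on th H by exact: sclosure_shift_continuous.
split; last 2 first.
- by move=> s t g _; exact: tshiftD.
- exact: cH.
- move=> t g Hg; have [wg clg] := Hg; split; first exact: WTC_tshift.
  move=> F eps eps0.
  have [d [F' [eta [d0 eta0 c]]]] := cH t g Hg F eps eps0.
  have [e Oe ne] := clg F' eta eta0.
  exists (tshift t e); last first.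
    by apply: c ne; [exact: sclosure_sub|rewrite subrr normr0].
  by have [s _ <-] := Oe; exists (s + t).
- by move=> g _; apply/funext => u; rewrite /tshift addr0.
Qed.
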